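(* The linear matrix equation $X=Af(X)B+C$ (unknown $X\in\mathbb{C}^{m\times m}$) is solvable if and only if the Stein matrix equation $\mathcal{X}=\mathcal{A}\mathcal{X}\mathcal{B}+\mathcal{C}$ (unknown $\mathcal{X}\in\mathbb{C}^{m\times m}$) is solvable. Furthermore, $X=Af(X)B+C$ has a unique solution $X$ if $\mathcal{X}=\mathcal{A}\mathcal{X}\mathcal{B}+\mathcal{C}$ has a unique solution $\mathcal{X}$.
   Context: Let $m,n\ge 1$ be integers, $A,B,C\in\mathbb{C}^{m\times m}$, and let $f:\mathbb{C}^{m\times m}\to\mathbb{C}^{m\times m}$ satisfy (1) (''linear'' in the paper's sense) $f(PQ+RS)=f(P)f(Q)+f(R)f(S)$ for all $P,Q,R,S\in\mathbb{C}^{m\times m}$; (2) (period-$n$) $n$ is the least positive integer such that $f^{(n)}(P)=P$ for all $P\in\mathbb{C}^{m\times m}$. Here $f^{(i)}$ is the $i$-fold composition of $f$ with itself, and $f^{(0)}$ is the identity map. For $i\ge 1$ and $X\in\mathbb{C}^{m\times m}$ set $G_i(X)=\Big(\prod_{j=1}^i f^{(j-1)}(A)\Big) f^{(i)}(X)\Big(\prod_{j=1}^i f^{(i-j)}(B)\Big)$, with products ordered from left to right in increasing $j$, i.e. $G_i(X)=A f(A)\cdots f^{(i-1)}(A)\, f^{(i)}(X)\, f^{(i-1)}(B)\cdots f(B)B$; and $G_0(X)=X$. Set $\mathcal{A}=\prod_{i=1}^n f^{(i-1)}(A)=A f(A)\cdots f^{(n-1)}(A)$, $\mathcal{B}=\prod_{i=1}^n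 f^{(n-i)}(B)=f^{(n-1)}(B)\cdots f(B)B$, and $\mathcal{C}=\sum_{i=1}^{n}G_{i-1}(C)$. *)

(* Defs.v *)
From HB Require Import structures.
From mathcomp Require Import all_boot all_order all_algebra.
From mathcomp Require Import reals complex.

Set Implicit Arguments.
Unset Strict Implicit.
Unset Printing Implicit Defensive.

Import Order.TTheory GRing.Theory Num.Theory.
Local Open Scope ring_scope.

(* For [R : realType], [R[i]] is the field of complex numbers and ['M[R[i]]_m]
   carries its usual ring structure: [*] is the (noncommutative) matrix
   product, and [\prod] multiplies from left to right in increasing index. *)

Definition preserves_sum_of_products (R : realType) (m : nat)
    (f : 'M[R[i]]_m -> 'M[R[i]]_m) : Prop :=
  forall P Q U V : 'M[R[i]]_m, f (P * Q + U * V) = f P * f Q + f U * f V.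

Definition has_period (R : realType) (m n : nat)
    (f : 'M[R[i]]_m -> 'M[R[i]]_m) : Prop :=
  [/\ (0 < n)%N,
      forall P : 'M[R[i]]_m, iter n f P = P
    & forall k : nat, (0 < k)%N ->
        (forall P : 'M[R[i]]_m, iter k f P = P) -> (n <= k)%N].

(* A f(A) ... f^(k-1)(A) *)
Definition lprod (R : realType) (m : nat)
    (f : 'M[R[i]]_m -> 'M[R[i]]_m) (A : 'M[R[i]]_m) (k : nat) : 'M[R[i]]_m :=
  \prod_(1 <= j < k.+1) iter (j - 1)%N f A.

(* f^(k-1)(B) ... f(B) B *)
Definition rprod (R : realType) (m : nat)
    (f : 'M[R[i]]_m -> 'M[R[i]]_m) (B : 'M[R[i]]_m) (k : nat) : 'M[R[i]]_m :=
  \prod_(1 <= j < k.+1) iter (k - j)%N f B.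

(* For [k = 0] both products are empty, so that [Gmap f A B 0 X = X]. *)
Definition Gmap (R : realType) (m : nat)
    (f : 'M[R[i]]_m -> 'M[R[i]]_m) (A B : 'M[R[i]]_m) (k : nat)
    (X : 'M[R[i]]_m) : 'M[R[i]]_m :=
  lprod f A k * iter k f X * rprod f B k.

Definition Gsum (R : realType) (m : nat)
    (f : 'M[R[i]]_m -> 'M[R[i]]_m) (A B C : 'M[R[i]]_m) (n : nat)
    : 'M[R[i]]_m :=
  \sum_(1 <= k < n.+1) Gmap f A B (k - 1)%N C.

(* Main.v *)
(** A surjective [f] preserving sums of products is a ring morphism, so
    [T X = A * f X * B + C] is an affine map of the additive group of matrices,
    and the Stein map is its [n]-th iterate. A fixed point of [T] is one of
    [T^n]; conversely, if [T^n Y = Y], then the mean of the orbit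
    [Y, T Y, ..., T^(n-1) Y] is fixed by [T], since additive maps commute with
    division by [n]. *)
Require Import Defs.
From HB Require Import structures.
From mathcomp Require Import all_boot all_order all_algebra.
From mathcomp Require Import reals complex.

Import Order.TTheory GRing.Theory Num.Theory.
Local Open Scope ring_scope.

Lemma affine_periodic_fixpoint (K : numFieldType) (V : lmodType K)
    (L : {additive V -> V}) (c y : V) (n : nat) (T := fun x => L x + c) :
  (0 < n)%N -> iter n T y = y -> exists x, x = T x.
Proof.
case: n => // n _ Ty; exists (n.+1%:R^-1 *: \sum_(k < n.+1) iter k T y).
have n0 : n.+1%:R != 0 :> K by rewrite pnatr_eq0.
(* [L] is only additive, so the denominator is cleared first: natural multiples do pass through
   [L]. *)
apply: (scalerI n0); rewrite scalerDr -(raddfZnat L) scalerA divff // scale1r.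
have -> : n.+1%:R *: c = \sum_(k < n.+1) c.
  by rewrite sumr_const card_ord scaler_nat.
rewrite raddf_sum -big_split /=.
(* Applying [T] shifts the orbit cyclically: the last term on the right is [y] by periodicity, which
   is the first term on the left. *)
by rewrite [RHS]big_ord_recr /= [L _ + c]Ty big_ord_recl addrC.
Qed.

(** The identity at [P * 1 + 0 * 0], with [P] a preimage of [0] and then of [1], gives
    [f 0 * f 0 = 0] and [f 1 = 1]; setting factors to [1] or [0] then yields the morphism laws. *)
Lemma preserves_sum_of_products_rmorphism (R : realType) (m : nat)
    (f g : 'M[R[i]]_m -> 'M[R[i]]_m) :
  preserves_sum_of_products f -> cancel g f ->
  exists F : {rmorphism 'M[R[i]]_m -> 'M[R[i]]_m}, F = f :> ('M[R[i]]_m -> 'M[R[i]]_m).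
Proof.
move=> fl gK.
have fE P : f P = f P * f 1 + f 0 * f 0 by rewrite -fl mulr1 mulr0 addr0.
have ff0 : f 0 * f 0 = 0 by have := fE (g 0); rewrite gK mul0r add0r.
have f0 : f 0 = 0.
  by have := fl 0 0 0 0; rewrite mulr0 addr0 ff0 addr0.
have f1 : f 1 = 1 by have := fE (g 1); rewrite gK mul1r ff0 addr0.
have fD : {morph f : P Q / P + Q}.
  by move=> P Q; have := fl P 1 Q 1; rewrite f1 !mulr1.
have fM : {morph f : P Q / P * Q}.
  by move=> P Q; have := fl P Q 0 0; rewrite ff0 mulr0 !addr0.
pose nM := GRing.isNmodMorphism.Build _ _ f (f0, fD).
pose mM := GRing.isMonoidMorphism.Build _ _ f (f1, fM).
pose F : {rmorphism 'M[R[i]]_m -> 'M[R[i]]_m} := HB.pack f nM mM.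
by exists F.
Qed.

Section GmapTheory.
Variables (R : realType) (m : nat) (f : {rmorphism 'M[R[i]]_m -> 'M[R[i]]_m}).
Implicit Types A B C X : 'M[R[i]]_m.

(** Applying [f] raises every exponent by one, so the factor with exponent 0 splits off: on the left
    here, on the right in [rprodS]. *)
Lemma lprodS A k : lprod f A k.+1 = A * f (lprod f A k).
Proof.
rewrite /lprod !big_add1 /= big_nat_recl // rmorph_prod; congr (_ * _).
by apply: eq_bigr => j _; rewrite !subn1.
Qed.

Lemma rprodS B k : rprod f B k.+1 = f (rprod f B k) * B.
Proof.
rewrite /rprod !big_add1 /= big_nat_recr //= subnn rmorph_prod; congr (_ * _).
by apply: eq_big_nat => j /andP[_ jk]; rewrite subSn.
Qed.

Lemma GmapS A B X k : Gmap f A B k.+1 X = A * f (Gmap f A B k X) * B.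
Proof. by rewrite /Gmap lprodS rprodS !rmorphM /= !mulrA. Qed.

Lemma Gmap0 A B X : Gmap f A B 0 X = X.
Proof. by rewrite /Gmap /lprod /rprod !big_geq // mul1r mulr1. Qed.

Lemma GsumS A B C k : Gsum f A B C k.+1 = A * f (Gsum f A B C k) * B + C.
Proof.
rewrite /Gsum !big_add1 /= big_nat_recl // Gmap0 addrC; congr (_ + _).
rewrite raddf_sum mulr_sumr mulr_suml.
by apply: eq_bigr => j _; rewrite !subn1 GmapS.
Qed.

(** [Gmap] iterates the linear part and [Gsum] is the orbit of [0]. At a period of [f], this is the
    Stein map. *)
Lemma iter_affine A B C X k :
  iter k (fun Y => A * f Y * B + C) X = Gmap f A B k X + Gsum f A B C k.
Proof.
elim: k => [|k IHk]; first by rewrite Gmap0 /Gsum big_geq // addr0.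
by rewrite iterS IHk GmapS GsumS raddfD mulrDr mulrDl addrA.
Qed.

End GmapTheory.

Theorem theorem3p1 (R : realType) (m n : nat) (hm : (0 < m)%N) (hn : (0 < n)%N)
    (A B C : 'M[R[i]]_m) (f : 'M[R[i]]_m -> 'M[R[i]]_m)
    (f_linear : preserves_sum_of_products f) (f_period : has_period n f) :
  ((exists X : 'M[R[i]]_m, X = A * f X * B + C) <->
   (exists Y : 'M[R[i]]_m, Y = lprod f A n * Y * rprod f B n + Gsum f A B C n))
  /\
  ((exists! Y : 'M[R[i]]_m, Y = lprod f A n * Y * rprod f B n + Gsum f A B C n) ->
   (exists! X : 'M[R[i]]_m, X = A * f X * B + C)).
Proof.
have [_ fn _] := f_period.
(* Periodicity provides the right inverse that makes [f] surjective. *)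
have gK : cancel (iter n.-1 f) f by move=> P; rewrite -iterS prednK.
have [F fF] := preserves_sum_of_products_rmorphism _ _ _ _ f_linear gK.
pose T X := A * f X * B + C.
have TnE X : iter n T X = lprod f A n * X * rprod f B n + Gsum f A B C n.
  by rewrite /T -fF iter_affine /Gmap fF fn.
have fixTn X : X = T X -> X = iter n T X by move=> XT; rewrite iter_fix.
have fixT Y : Y = iter n T Y -> exists X, X = T X.
  (* Linearity over the scalars can fail, for instance when [F] conjugates entries. *)
  have LD : zmod_morphism (fun X => A * F X * B).
    by move=> P Q; rewrite raddfB mulrBr mulrBl.
  pose aL := GRing.isZmodMorphism.Build _ _ (fun X => A * F X * B) LD.
  pose L : {additive 'M[R[i]]_m -> 'M[R[i]]_m} :=
    HB.pack (fun X => A * F X * B) aL.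
  have TL : T =1 (fun X => L X + C) by move=> X; rewrite /T -fF.
  move=> /esym; rewrite (eq_iter TL) => /(affine_periodic_fixpoint _ _ _ _ _ _ hn).
  by case=> X XT; exists X; rewrite TL.
split; first split.
- by case=> X /fixTn; rewrite TnE; exists X.
- by case=> Y; rewrite -TnE => /fixT.
case=> Y [YE Yuniq]; have [X XT] : exists X, X = T X.
  by apply: (fixT Y); rewrite TnE.
exists X; split=> // X' X'T.
(* Every fixed point of [T] solves the Stein equation, hence equals [Y]. *)
have YX Z : Z = T Z -> Y = Z by move=> /fixTn; rewrite TnE => /Yuniq.
by rewrite -(YX X XT) -(YX X' X'T).
Qed.
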